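(* Let $H>0$, $\alpha>1$, $T\in\mathbb{N}$, ${\bf W}=\{0,1,2,\ldots\}$, let $\{X(\alpha^n),n\in{\bf W}\}$ be a zero-mean discrete time scale invariant Markov (DT-SIM) process with index $H$ and scale $l=\alpha^T$, and let $\{W(l^n),n\in{\bf W}\}$ be its associated $T$-dimensional discrete time self-similar Markov process $W(l^n)=(W^0(l^n),\ldots,W^{T-1}(l^n))$, $W^k(l^n)=X(\alpha^{nT+k})$, $k=0,\ldots,T-1$. Then the spectral density matrix ${\bf d}^H(\omega)=[{\bf d}^H_{jr}(\omega)]_{j,r=0,\ldots,T-1}$ of $\{W(l^n),n\in{\bf W}\}$ is specified by $${\bf d}^H_{jr}(\omega)=\frac1{2\pi}\left[\frac{\tilde h(\alpha^{j-1})R^H_r(0)}{\tilde h(\alpha^{r-1})\big(1-e^{-i\omega T}\alpha^{-HT}\tilde h(\alpha^{T-1})\big)}-\frac{\tilde h(\alpha^{r-1})R^H_j(0)}{\tilde h(\alpha^{j-1})\big(1-e^{-i\omega T}\alpha^{HT}\tilde h^{-1}(\alpha^{T-1})\big)}\right],$$ where $R^H_k(0)$ is the variance of $X(\cdot)$ at the point $\alpha^k$, $\tilde h(\alpha^r)=\prod_{j=0}^{r}R^H_j(1)/R^H_j(0)$ for $r\geq 0$, and $\tilde h(\alpha^{-1})=1$.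
   Context: Processes are real-valued. A zero-mean process $\{X(\alpha^n),n\in{\bf W}\}$ is discrete time scale invariant (DT-SI, in the wide sense) with index $H>0$ and scale $l=\alpha^T$ if $E[X^2(\alpha^n)]<\infty$ for all $n$ and $E[X(\alpha^{n+T})X(\alpha^{m+T})]=\alpha^{2TH}E[X(\alpha^n)X(\alpha^m)]$ for all $n,m\in{\bf W}$. It is DT-SIM if in addition it is Markov in the wide sense: for all $n<m$ the best linear mean-square predictor of $X(\alpha^m)$ given $\{X(\alpha^k):k\le n\}$ equals the best linear predictor given $X(\alpha^n)$ alone. Notation: $R^H_n(\tau)=E[X(\alpha^{n+\tau})X(\alpha^n)]$. Standing assumption: $R^H_n(\tau)\ne0$ for all $n,\tau$. Covariances of $W$: $Q^H_{jr}(l^s)=E[W^j(l^s)W^r(1)]=E[X(\alpha^{sT+j})X(\alpha^r)]$ for $s\in{\bf W}$, and, by self-similarity, $Q^H_{jr}(l^{-s})=l^{-2sH}Q^H_{rj}(l^s)$ for $s\ge1$. The spectral density matrix of $\{W(l^n)\}$ is, by definition (with the frequency normalization used for sampling at the points $l^n=\alpha^{nT}$), $${\bf d}^H_{jr}(\omega)=\frac1{2\pi}\sum_{s=-\infty}^{\infty}l^{-Hs}e^{-i\omega sT}Q^H_{jr}(l^s),\qquad j,r=0,\ldots,T-1 .$$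
   Formalization: For j<r the printed formula has a wrong s=0 term; the term (1/2π)(A_rj−A_jr) is added, A_jr = h̃(α^{j-1})R_r(0)/h̃(α^{r-1}). The formula holds wherever the defining series converges, which is proved unless |α^{-HT}h̃(α^{T-1})|=1, where it diverges. *)

(* Defs.v *)
From HB Require Import structures.
From mathcomp Require Import all_boot all_order all_algebra.
From mathcomp Require Import complex.
From mathcomp Require Import all_classical all_reals all_analysis.
Set Implicit Arguments.
Unset Strict Implicit.
Unset Printing Implicit Defensive.
Import Order.TTheory GRing.Theory Num.Theory.
Import numFieldNormedType.Exports.
Local Open Scope classical_set_scope.
Local Open Scope complex_scope.
Local Open Scope ring_scope.

(* The sums over s >= 0 and over s < 0 both converge, with total l. *)
Definition two_sided_sum (C : numFieldType) (a : int -> C) (l : C) :=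
  exists l1 l2 : C,
    [/\ (fun N : nat => \sum_(0 <= n < N) a (Posz n)) @ \oo --> l1,
        (fun N : nat => \sum_(0 <= n < N) a (Negz n)) @ \oo --> l2
      & l = l1 + l2].

(* A process {X(alpha^n), n = 0, 1, 2, ...} is a sequence X of real random
   variables in which X n stands for X(alpha^n). *)

Section processes.
Context (d : measure_display) (Om : measurableType d) (R : realType)
  (P : probability Om R).
Implicit Types (X : nat -> {RV P >-> R}) (alpha H : R) (T : nat).

(* E[X(alpha^m) X(alpha^n)] *)
Definition moment2 X (m n : nat) : R :=
  fine ('E_P[(fun w => X m w * X n w)%R])%E.

(* R^H_n(tau) = E[X(alpha^(n + tau)) X(alpha^n)] *)
Definition covR X (n tau : nat) : R := moment2 X (n + tau) n.

Definition zero_mean X := forall n : nat, ('E_P[X n] = 0)%E.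

Definition is_DT_SI X alpha H T :=
  (forall n : nat, ('E_P[(fun w => X n w ^+ 2)%R] < +oo)%E) /\
  (forall n m : nat,
     moment2 X (n + T) (m + T) = alpha `^ (2 * T%:R * H) * moment2 X n m).

Definition lin_comb X (s : seq nat) (c : nat -> R) : Om -> R :=
  fun w => \sum_(k <- s) c k * X k w.

Definition mean_square_error (Z Y : Om -> R) : \bar R :=
  ('E_P[(fun w => (Z w - Y w) ^+ 2)%R])%E.

Definition is_best_linear_predictor X (s : seq nat) (Z Y : Om -> R) :=
  (exists c : nat -> R, Y = lin_comb X s c) /\
  (forall c : nat -> R,
     (mean_square_error Z Y <= mean_square_error Z (lin_comb X s c))%E).

(* Best linear predictors are determined only up to a null set, so they are
   compared almost everywhere. *)
Definition is_wide_sense_Markov X :=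
  forall n m : nat, (n < m)%N -> forall Y Y' : Om -> R,
    is_best_linear_predictor X (iota 0 n.+1) (X m) Y ->
    is_best_linear_predictor X [:: n] (X m) Y' ->
    {ae P, forall w, Y w = Y' w}.

Definition is_DT_SIM X alpha H T :=
  is_DT_SI X alpha H T /\ is_wide_sense_Markov X.

(* W^k(l^n) = X(alpha^(n T + k)) *)
Definition assocW X T (n : nat) (k : 'I_T) : {RV P >-> R} := X (n * T + k)%N.

(* crossQ X alpha H j r s = Q^H_jr(l^s), where l = alpha^T; note that
   Negz n is the integer - n.+1. *)
Definition crossQ X alpha H T (j r : 'I_T) (s : int) : R :=
  match s with
  | Posz n => fine ('E_P[(fun w => assocW X n j w * assocW X 0 r w)%R])%E
  | Negz n => (alpha ^+ T) `^ (- (2 * n.+1%:R * H)) *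
      fine ('E_P[(fun w => assocW X n.+1 r w * assocW X 0 j w)%R])%E
  end.

Definition expi (theta : R) : R[i] := cos theta +i* sin theta.

(* D is the value at omega of the spectral density matrix of {W(l^n)}; in
   particular the series defining its entries converge. *)
Definition is_spectral_density_at X alpha H T (omega : R) (D : 'M[R[i]]_T) :=
  forall j r : 'I_T, exists S : R[i],
    two_sided_sum (fun s : int =>
      ((alpha ^+ T) `^ (- (H * s%:~R)))%:C *
      expi (- (omega * s%:~R * T%:R)) *
      (crossQ X alpha H j r s)%:C) S /\
    D j r = ((2 * pi)^-1)%:C * S.

(* htilde X r = \tilde h(alpha^r); the only negative index used is -1. *)
Definition htilde X (r : int) : R :=
  match r with
  | Posz n => \prod_(0 <= j < n.+1) (covR X j 1 / covR X j 0)
  | Negz _ => 1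
  end.

End processes.

(* Main.v *)
(* The best linear predictor of X_m given X_0, ..., X_n exists (Gram-Schmidt)
   and its error is orthogonal to X_0, ..., X_n.  By the Markov property it is
   the multiple of X_n given by the one-variable regression, so that
   E[X_m X_k] = E[X_m X_n] / E[X_n^2] * E[X_n X_k] for k <= n < m.  Iterating,
   E[X_m X_k] = htilde(m - 1) / htilde(k - 1) * E[X_k^2] for k <= m, and scale
   invariance makes htilde multiplicative along multiples of T.  Both halves of
   the spectral series are thus geometric, up to the term s = 0 when j < r, with
   ratios e^(-i omega T) q and e^(i omega T) q, where
   q = alpha^(-HT) htilde(T - 1).  Cauchy-Schwarz gives |q| <= 1, so the series
   converges as soon as |q| <> 1; conversely the convergence of a nonzero
   geometric series forces its ratio to be different from 1. *)

Require Import Defs.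
From mathcomp Require Import all_boot all_order all_algebra.
From mathcomp Require Import complex ring.
From mathcomp Require Import all_classical all_reals all_analysis.
Set Implicit Arguments.
Unset Strict Implicit.
Unset Printing Implicit Defensive.
Import Order.TTheory GRing.Theory Num.Theory.
Import numFieldNormedType.Exports.
Local Open Scope classical_set_scope.
Local Open Scope complex_scope.
Local Open Scope ring_scope.

(** * Semi-inner products: Cauchy-Schwarz and orthogonal projection *)

Section semi_inner_product.
Context (R : realFieldType) (V : lmodType R) (dot : V -> V -> R).
Context (dotC : forall u v, dot u v = dot v u).
Context (dotDl : forall u v w, dot (u + v) w = dot u w + dot v w).
Context (dotZl : forall a u w, dot (a *: u) w = a * dot u w).
Context (dot_ge0 : forall u, 0 <= dot u u).
Implicit Types (u v w z : V) (x : nat -> V) (c : nat -> R) (s : seq nat).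

Lemma dot0l w : dot 0 w = 0.
Proof. by rewrite -(scale0r 0) dotZl mul0r. Qed.

Lemma dotBl u v w : dot (u - v) w = dot u w - dot v w.
Proof. by rewrite -scaleN1r dotDl dotZl mulN1r. Qed.

Lemma dotBr u v w : dot w (u - v) = dot w u - dot w v.
Proof. by rewrite dotC dotBl !(dotC w). Qed.

Lemma dotDr u v w : dot w (u + v) = dot w u + dot w v.
Proof. by rewrite dotC dotDl !(dotC w). Qed.

Lemma dotZr a u w : dot w (a *: u) = a * dot w u.
Proof. by rewrite dotC dotZl dotC. Qed.

Lemma dot_suml s c x w :
  dot (\sum_(k <- s) c k *: x k) w = \sum_(k <- s) c k * dot (x k) w.
Proof.
elim: s => [|k s IHs]; first by rewrite !big_nil dot0l.
by rewrite !big_cons dotDl dotZl IHs.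
Qed.

(** Pythagoras; it will turn orthogonality of the error into minimality. *)
Lemma dot_sqrB_ortho z u v : dot (z - u) (u - v) = 0 ->
  dot (z - v) (z - v) = dot (z - u) (z - u) + dot (u - v) (u - v).
Proof.
move=> ort; have -> : z - v = (z - u) + (u - v) by rewrite addrA subrK.
move: (z - u) (u - v) ort => p q pq.
by rewrite dotDl !dotDr [dot q p]dotC pq addr0 add0r.
Qed.

(** The form is only semi-definite, so [dot v v = 0] needs its own argument. *)
Lemma dot_cauchy_schwarz u v : dot u v ^+ 2 <= dot u u * dot v v.
Proof.
have [v0|v0] := eqVneq (dot v v) 0; last first.
  have v_gt0 : 0 < dot v v by rewrite lt_neqAle eq_sym v0 dot_ge0.
  have := dot_ge0 (u - (dot u v / dot v v) *: v).
  rewrite dotBl !dotBr !dotZl !dotZr [dot v u]dotC divfK// subrr subr0.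
  by rewrite subr_ge0 mulrAC ler_pdivrMr// -expr2.
rewrite v0 mulr0; have [->|uv] := eqVneq (dot u v) 0; first by rewrite expr0n.
(* For [v] null and [dot u v] nonzero, this multiple of [v] is chosen to make the square of the
   difference equal to -1. *)
have := dot_ge0 (u - ((dot u u + 1) / (2 * dot u v)) *: v).
rewrite dotBl !dotBr !dotZl !dotZr [dot v u]dotC v0 !mulr0 subr0.
have -> : (dot u u + 1) / (2 * dot u v) * dot u v = (dot u u + 1) / 2.
  by field; rewrite uv.
rewrite -addrA -opprD -splitr opprD addNKr.
by rewrite ler0N1.
Qed.

Lemma dot_null u v : dot u u = 0 -> dot u v = 0.
Proof.
move=> u0; have := dot_cauchy_schwarz u v; rewrite u0 mul0r => uv.
by apply/eqP; rewrite -sqrf_eq0 eq_le uv sqr_ge0.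
Qed.

(* Gram-Schmidt step: the projection is corrected along the component of
   [x n] orthogonal to the previous vectors, unless that component is null. *)
Lemma ortho_projection_exists x n z : exists c, forall i, (i < n)%N ->
  dot (z - \sum_(k <- iota 0 n) c k *: x k) (x i) = 0.
Proof.
elim: n z => [z|n IHn z]; first by exists (fun=> 0).
have [b bP] := IHn (x n); have [c cP] := IHn z.
set pb := \sum_(k <- _) _ in bP; set pc := \sum_(k <- _) _ in cP.
pose e := x n - pb; pose t := dot (z - pc) e / dot e e.
exists (fun k => if k == n then t else c k - t * b k) => i.
have -> : \sum_(k <- iota 0 n.+1)
    (if k == n then t else c k - t * b k) *: x k = pc + t *: e.
  rewrite -addn1 iotaD big_cat big_seq1 /= eqxx.
  rewrite [X in X + _](_ : _ = pc - t *: pb).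
    by rewrite scalerBr addrA addrAC.
  rewrite /pc /pb scaler_sumr -sumrB [LHS]big_seq [RHS]big_seq.
  apply: eq_bigr => k; rewrite mem_iota add0n => /andP[_ kn].
  by rewrite ltn_eqF// scalerBl scalerA.
have orte u : (forall j, (j < n)%N -> dot u (x j) = 0) -> dot u pb = 0.
  move=> uP; rewrite dotC dot_suml big_seq big1// => k.
  by rewrite mem_iota add0n => /andP[_ kn]; rewrite dotC uP ?mulr0.
rewrite ltnS leq_eqVlt opprD addrA dotBl dotZl.
move=> /predU1P[->|lt_in]; last first.
  by rewrite cP// bP// mulr0 subrr.
have -> : x n = e + pb by rewrite subrK.
rewrite (dotDr e pb (z - pc)) (dotDr e pb e) (orte _ cP) (orte _ bP) !addr0.
(* If [e] is null, Cauchy-Schwarz makes it orthogonal to [z - pc], whatever the value of [t]. *)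
have [e0|e0] := eqVneq (dot e e) 0; last by rewrite /t divfK// subrr.
by rewrite e0 mulr0 subr0 dotC dot_null.
Qed.

End semi_inner_product.

(** * Geometric series, one-sided and two-sided *)

Section geometric_sums.
Context (C : numFieldType).
Implicit Types (a : int -> C) (c dlt l w z : C).

Lemma cvg_expr_neq1 z : (fun n => z ^+ n) @ \oo --> (0 : C) -> z != 1.
Proof.
move=> z0; apply/eqP => z1; move: z0; rewrite z1.
under eq_fun do rewrite expr1n.
by move/(cvg_unique (@norm_hausdorff _ _) (cvg_cst _))/eqP; rewrite oner_eq0.
Qed.

Lemma cvg_geometric_seriesP c z : (fun n => z ^+ n) @ \oo --> (0 : C) ->
  series (geometric c z) @ \oo --> c / (1 - z).
Proof.
move=> z0; have z1 := cvg_expr_neq1 z0.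
rewrite geometric_seriesE//=.
rewrite -[X in X / _]mulr1 -[X in c * X / _]subr0.
apply: cvgMr_tmp; apply: cvgMl_tmp; apply: cvgB => //; exact: cvg_cst.
Qed.

(** The terms of a convergent series tend to 0; dividing by [c], so do the powers of [z], which
    excludes [z = 1]. *)
Lemma geometric_series_lim c z l : c != 0 ->
  series (geometric c z) @ \oo --> l -> z != 1 /\ l = c / (1 - z).
Proof.
move=> c0 cl.
have z0 : (fun n => z ^+ n) @ \oo --> (0 : C).
  have /cvg_series_cvg_0 g0 : cvgn (series (geometric c z)).
    by apply/cvg_ex; exists l.
  have -> : (fun n => z ^+ n) = (fun n => c^-1 * geometric c z n).
    by apply/funext => n; rewrite /= mulKf.
  by rewrite -[X in _ --> X](mulr0 c^-1); exact: cvgMl_tmp g0.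
split; first exact: cvg_expr_neq1.
exact: (cvg_unique (@norm_hausdorff _ _) cl (cvg_geometric_seriesP z0)).
Qed.

(* The exceptional term [dlt] at [0] accounts for a sequence which is geometric
   only from index [1] on. *)
Lemma two_sided_sum_geometric a c1 c2 z w dlt l : c1 != 0 -> c2 * w != 0 ->
    (forall n, a (Posz n) = c1 * z ^+ n + (if n is 0%N then dlt else 0)) ->
    (forall n, a (Negz n) = c2 * w ^+ n.+1) ->
  two_sided_sum a l ->
  [/\ z != 1, w != 1 & l = c1 / (1 - z) + dlt + c2 * w / (1 - w)].
Proof.
move=> c1_0 c2w_0 apos aneg [l1 [l2 [h1 h2 ->]]].
have /(geometric_series_lim c1_0)[z1 l1E] :
    series (geometric c1 z) @ \oo --> l1 - dlt.
  (* After the shift every partial sum contains index 0, so removing [dlt] amounts to subtracting a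
     constant. *)
  rewrite -cvg_shiftS /=.
  have -> : (fun n => series (geometric c1 z) n.+1) =
            (fun n => \sum_(0 <= i < n.+1) a (Posz i) - dlt).
    apply/funext => n; rewrite /series /= !big_nat_recl//= apos.
    under [in RHS]eq_bigr do rewrite apos addr0.
    by ring.
  by apply: cvgB; [rewrite -cvg_shiftS in h1|exact: cvg_cst].
(* The negative half starts at exponent 1, hence the leading coefficient [c2 * w]. *)
have /(geometric_series_lim c2w_0)[w1 l2E] :
    series (geometric (c2 * w) w) @ \oo --> l2.
  have -> : series (geometric (c2 * w) w) =
            (fun N => \sum_(0 <= n < N) a (Negz n)).
    by apply/funext => N; apply: eq_bigr => n _; rewrite aneg exprS mulrA.
  exact: h2.
by split=> //; rewrite -l2E -l1E subrK.
Qed.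

Lemma two_sided_sum_geometric_cvg a c1 c2 z w dlt :
    (forall n, a (Posz n) = c1 * z ^+ n + (if n is 0%N then dlt else 0)) ->
    (forall n, a (Negz n) = c2 * w ^+ n.+1) ->
    (fun n => z ^+ n) @ \oo --> (0 : C) ->
    (fun n => w ^+ n) @ \oo --> (0 : C) ->
  two_sided_sum a (c1 / (1 - z) + dlt + c2 * w / (1 - w)).
Proof.
move=> apos aneg z0 w0.
exists (c1 / (1 - z) + dlt), (c2 * w / (1 - w)); split => //.
  rewrite -cvg_shiftS /=.
  have -> : (fun n => \sum_(0 <= i < n.+1) a (Posz i)) =
            (fun n => series (geometric c1 z) n.+1 + dlt).
    apply/funext => n; rewrite /series /= !big_nat_recl//= apos.
    under [in LHS]eq_bigr do rewrite apos addr0.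
    by ring.
  apply: cvgD; last exact: cvg_cst.
  by rewrite -/(series _) cvg_shiftS; exact: cvg_geometric_seriesP.
have -> : (fun N => \sum_(0 <= n < N) a (Negz n)) =
          series (geometric (c2 * w) w).
  by apply/funext => N; apply: eq_bigr => n _; rewrite aneg exprS mulrA.
exact: cvg_geometric_seriesP.
Qed.

End geometric_sums.

(** * Square-integrable variables with the product moment *)

Section L2.
Context d (Om : measurableType d) (R : realType) (P : probability Om R).
Local Notation L2 := (LfunType P (lee1n 2)).

(** The elements are functions, not classes modulo null sets, so this form is only semi-definite. *)
Definition L2dot (f g : L2) : R := fine 'E_P[(fun w => f w * g w)%R]%E.

Lemma L2_mul_Lfun1 (f g : L2) : (fun w => f w * g w) \in Lfun P 1.
Proof. by apply: Lfun2_mul_Lfun1; exact: LfunP. Qed.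

Lemma expectation_L2dot (f g : L2) :
  'E_P[(fun w => f w * g w)%R]%E = (L2dot f g)%:E.
Proof. by rewrite fineK// expectation_fin_num// L2_mul_Lfun1. Qed.

Lemma L2dotC f g : L2dot f g = L2dot g f.
Proof. by rewrite /L2dot; under eq_fun do rewrite mulrC. Qed.

Lemma L2dotDl f g h : L2dot (f + g) h = L2dot f h + L2dot g h.
Proof.
apply: EFin_inj; rewrite (EFinD (L2dot f h)).
rewrite -(expectation_L2dot (f + g)) -(expectation_L2dot f)
  -(expectation_L2dot g).
rewrite -expectationD ?L2_mul_Lfun1//.
by congr expectation; apply/funext => w /=; rewrite -mulrDl.
Qed.

Lemma L2dotZl a f h : L2dot (a *: f) h = a * L2dot f h.
Proof.
apply: EFin_inj; rewrite EFinM.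
rewrite -(expectation_L2dot (a *: f)) -(expectation_L2dot f).
rewrite -expectationZl ?L2_mul_Lfun1//.
by congr expectation; apply/funext => w /=; rewrite [RHS]mulrC mulrA.
Qed.

Lemma L2dot_ge0 f : 0 <= L2dot f f.
Proof.
by rewrite fine_ge0// expectation_ge0// => w; rewrite -expr2 sqr_ge0.
Qed.

Lemma L2dot_ae (f g h : L2) : {ae P, forall w, f w = g w} ->
  L2dot f h = L2dot g h.
Proof.
move=> fg; apply: EFin_inj.
rewrite -(expectation_L2dot f) -(expectation_L2dot g) unlock.
apply: ae_eq_integral => //.
- by have /Lfun1_integrable/measurable_int := L2_mul_Lfun1 f h.
- by have /Lfun1_integrable/measurable_int := L2_mul_Lfun1 g h.
- by apply: filterS fg => w /= ->.
Qed.

Lemma sqr_integrable_Lfun2 (Y : {RV P >-> R}) :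
  ('E_P[(fun w => Y w ^+ 2)%R] < +oo)%E -> (Y : Om -> R) \in Lfun P 2%:E.
Proof.
rewrite unlock => Y2; apply/andP; split; rewrite inE//=.
rewrite /finite_norm unlock /Lnorm; apply: poweR_lty.
under eq_integral do rewrite /= powR_mulrn// -normrX ger0_norm ?sqr_ge0//.
exact: Y2.
Qed.

End L2.

(** * Best linear prediction and the covariances of the process *)

Section second_order_process.
Context d (Om : measurableType d) (R : realType) (P : probability Om R).
Context (X : nat -> {RV P >-> R}).
Context (X2 : forall n, ('E_P[(fun w => X n w ^+ 2)%R] < +oo)%E).
Local Notation L2 := (LfunType P (lee1n 2)).

Definition L2X n : L2 := Lfun_Sub (lee1n 2) (sqr_integrable_Lfun2 (X2 n)).

Lemma moment2_L2dot m n : moment2 X m n = L2dot (L2X m) (L2X n).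
Proof. by []. Qed.

Lemma moment2C m n : moment2 X m n = moment2 X n m.
Proof. by rewrite !moment2_L2dot L2dotC. Qed.

Lemma moment2_cauchy_schwarz m n :
  moment2 X m n ^+ 2 <= moment2 X m m * moment2 X n n.
Proof.
rewrite !moment2_L2dot; apply: (dot_cauchy_schwarz (dot := @L2dot _ _ _ P)).
- exact: L2dotC.
- exact: L2dotDl.
- exact: L2dotZl.
- exact: L2dot_ge0.
Qed.

Lemma lin_comb_L2 s c : lin_comb X s c = (\sum_(k <- s) c k *: L2X k : L2).
Proof.
elim: s => [|k s IHs]; apply/funext => w; rewrite /lin_comb.
  by rewrite !big_nil.
by rewrite !big_cons; congr (_ + _); rewrite -[LHS]/(lin_comb X s c w) IHs.
Qed.

Lemma mean_square_error_L2 (f g : L2) :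
  mean_square_error P f g = (L2dot (f - g) (f - g))%:E.
Proof.
rewrite -(expectation_L2dot (f - g)); exact: congr1.
Qed.

(** Orthogonality principle: any other combination differs from this one by an element of the span,
    which is orthogonal to the error, so Pythagoras applies. *)
Lemma ortho_best_linear_predictor (Z : L2) s c :
    (forall i, i \in s ->
      L2dot (Z - \sum_(k <- s) c k *: L2X k) (L2X i) = 0) ->
  is_best_linear_predictor X s Z (lin_comb X s c).
Proof.
move=> ort; split=> [|c']; first by exists c.
rewrite !lin_comb_L2 !mean_square_error_L2 lee_fin.
have dotC := @L2dotC _ _ _ P; have dotDl := @L2dotDl _ _ _ P.
have dotZl := @L2dotZl _ _ _ P.
set u := \sum_(k <- s) c k *: _; set v := \sum_(k <- s) c' k *: _.
have -> : L2dot (Z - v) (Z - v) = _ := dot_sqrB_ortho (u := u) dotC dotDl _.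
  by rewrite lerDl L2dot_ge0.
rewrite -sumrB; under eq_bigr do rewrite -scalerBl.
rewrite dotC (dot_suml dotDl dotZl) big_seq big1// => i si.
by rewrite dotC ort ?mulr0.
Qed.

Context (X_Markov : is_wide_sense_Markov X).
Context (X_neq0 : forall n, moment2 X n n != 0).

Lemma Markov_moment2 k n m : (k <= n)%N -> (n < m)%N ->
  moment2 X m k = moment2 X m n / moment2 X n n * moment2 X n k.
Proof.
move=> kn nm.
have dotC := @L2dotC _ _ _ P; have dotDl := @L2dotDl _ _ _ P.
have dotZl := @L2dotZl _ _ _ P; have dot_ge0 := @L2dot_ge0 _ _ _ P.
have [c cP] :=
  ortho_projection_exists dotC dotDl dotZl dot_ge0 L2X n.+1 (L2X m).
pose b := fun _ : nat => moment2 X m n / moment2 X n n.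
have bestY : is_best_linear_predictor X (iota 0 n.+1) (X m)
    (lin_comb X (iota 0 n.+1) c).
  apply: (ortho_best_linear_predictor (Z := L2X m)) => i.
  by rewrite mem_iota => /andP[_]; exact: cP.
have bestY' : is_best_linear_predictor X [:: n] (X m) (lin_comb X [:: n] b).
  apply: (ortho_best_linear_predictor (Z := L2X m)) => i.
  rewrite inE => /eqP ->; rewrite big_seq1 (dotBl dotDl dotZl) dotZl.
  by rewrite -!moment2_L2dot divfK ?subrr.
(* The predictors agree almost everywhere, so they have the same product moment with X_k; for the
   first it is E[X_m X_k], its error being orthogonal to X_k. *)
have := X_Markov nm bestY bestY'; rewrite !lin_comb_L2 big_seq1.
move=> /(L2dot_ae (L2X k)).
have /eqP := cP k kn; rewrite (dotBl dotDl dotZl) subr_eq0 => /eqP <-.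
by rewrite dotZl.
Qed.

(* The paper's [htilde], shifted by one to avoid the index [-1]. *)
Definition hprod n : R := \prod_(0 <= j < n) (covR X j 1 / covR X j 0).

Lemma htilde_hprod n : htilde X (n%:Z - 1) = hprod n.
Proof.
case: n => [|n]; first by rewrite /hprod big_nil.
by rewrite -addn1 PoszD addrK /= addn1.
Qed.

Lemma covR0 n : covR X n 0 = moment2 X n n.
Proof. by rewrite /covR addn0. Qed.

Context (X_cov1_neq0 : forall n, covR X n 1 != 0).

Lemma hprod_neq0 n : hprod n != 0.
Proof.
rewrite /hprod; elim: n => [|n IHn]; first by rewrite big_nil oner_neq0.
by rewrite big_nat_recr//= mulf_neq0// mulf_neq0// ?invr_neq0// covR0.
Qed.

(** Induction on [m]: each Markov step multiplies by the regression coefficient of X_(m+1) on X_m,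
    which is the next factor of [hprod]. *)
Lemma moment2_hprod k m : (k <= m)%N ->
  moment2 X m k = hprod m / hprod k * covR X k 0.
Proof.
have diag n : moment2 X n n = hprod n / hprod n * covR X n 0.
  by rewrite divff ?hprod_neq0// mul1r covR0.
elim: m => [|m IHm]; first by rewrite leqn0 => /eqP->.
rewrite leq_eqVlt => /predU1P[->//|].
rewrite ltnS => km; rewrite (Markov_moment2 km (ltnSn m)) IHm//.
have -> : hprod m.+1 = hprod m * (moment2 X m.+1 m / moment2 X m m).
  by rewrite /hprod big_nat_recr//= covR0 /covR addn1.
by rewrite mulrA; congr (_ * _); rewrite [LHS]mulrC [LHS]mulrAC.
Qed.

Context (lam : R) (T : nat) (lam_neq0 : lam != 0).
Context (X_SI : forall n m, moment2 X (n + T) (m + T) = lam * moment2 X n m).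

(** The factors of [hprod] are T-periodic, since scale invariance multiplies numerator and
    denominator by the same [lam]; each full period contributes [hprod T]. *)
Lemma hprodD n m : hprod (n * T + m) = hprod T ^+ n * hprod m.
Proof.
have ratio i k : covR X (i + k * T) 1 / covR X (i + k * T) 0 =
    covR X i 1 / covR X i 0.
  elim: k => [|k IHk]; first by rewrite mul0n addn0.
  have covT j tau : covR X (j + T) tau = lam * covR X j tau.
    by rewrite /covR addnAC X_SI.
  by rewrite mulSnr addnA !covT -mulf_div divff// mul1r.
elim: n => [|n IHn]; first by rewrite mul0n expr0 mul1r.
rewrite mulSn -addnA exprS -mulrA -IHn /hprod.
rewrite (big_cat_nat (n := T))//= ?leq_addr//; congr (_ * _).
rewrite -{1}[T]add0n big_addn addKn; apply: eq_bigr => i _.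
by have := ratio i 1%N; rewrite mul1n.
Qed.

(** Cauchy-Schwarz for X_T and X_0, with E[X_T^2] = lam E[X_0^2]. *)
Lemma hprod_sqr_le : hprod T ^+ 2 <= lam.
Proof.
have := moment2_cauchy_schwarz T 0.
have -> : moment2 X T 0 = hprod T * moment2 X 0 0.
  rewrite moment2_hprod// covR0; congr (_ * _).
  by rewrite [hprod 0]/hprod big_nil divr1.
have := X_SI 0 0; rewrite add0n => ->.
have X00 : 0 < moment2 X 0 0.
  by rewrite lt_neqAle eq_sym X_neq0 moment2_L2dot L2dot_ge0.
by rewrite exprMn -mulrA -expr2 ler_pM2r// exprn_gt0.
Qed.

End second_order_process.

(** * Complex exponentials of real angles *)

Section complex_exponential.
Context (R : realType).
Implicit Types (x y : R) (z : R[i]).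

Lemma expiD x y : expi (x + y) = expi x * expi y.
Proof.
rewrite /expi cosD sinD; apply/eqP; rewrite eq_complex /=.
by rewrite eqxx/= addrC eqxx.
Qed.

Lemma expi0 : expi (0 : R) = 1.
Proof. by rewrite /expi cos0 sin0. Qed.

Lemma expiMn x n : expi (x * n%:R) = expi x ^+ n.
Proof.
elim: n => [|n IHn]; first by rewrite mulr0 expi0 expr0.
by rewrite -natr1 mulrDr mulr1 expiD IHn exprSr.
Qed.

Lemma norm_expi x : `|expi x| = 1.
Proof. by rewrite normc_def /= cos2Dsin2 sqrtr1. Qed.

Lemma expi_neq0 x : expi x != 0.
Proof. by rewrite -normr_eq0 norm_expi oner_neq0. Qed.

Lemma expiN x : expi (- x) = (expi x)^-1.
Proof.
apply: (mulIf (expi_neq0 x)).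
by rewrite -expiD addNr expi0 mulVf ?expi_neq0.
Qed.

Lemma cvg_expi_geometric x (q : R) : `|q| < 1 ->
  (fun n => (expi x * q%:C) ^+ n : (R[i] : numFieldType)) @ \oo -->
  (0 : (R[i] : numFieldType)).
Proof.
move=> /cvg_expr /cvgr0Pnorm_lt q0; apply/cvgr0Pnorm_lt => e.
(* In [R[i]], [0 < e] forces [e] to be real, so the estimate reduces to its real part. *)
rewrite ltcE /= => /andP[/eqP e0 /q0]; apply: filterS => n.
move=> qn; suff : `|(expi x * q%:C) ^+ n| < e by [].
rewrite exprMn normrM normrX norm_expi expr1n mul1r -rmorphXn normc_def /=.
by rewrite expr0n/= addr0 sqrtr_sqr ltcE /= -e0 eqxx.
Qed.

End complex_exponential.

(** * Geometric weights and the entries of the spectral density matrix *)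

Lemma powR_geometric (R : realType) (alpha x : R) (T n : nat) : 0 < alpha ->
  (alpha ^+ T) `^ (x * n%:R) = (alpha `^ (x * T%:R)) ^+ n.
Proof.
move=> alpha_gt0; rewrite -powR_mulrn ?ltW// -powRrM.
rewrite -[RHS]powR_mulrn ?powR_ge0// -powRrM; congr (_ `^ _); ring.
Qed.

(** Value and existence are separated: the first part takes convergence from the definition of the
    density, the second derives it when the ratio does not have modulus 1. *)
Theorem lemma3p4 (d : measure_display) (Om : measurableType d) (R : realType)
  (P : probability Om R) (X : nat -> {RV P >-> R}) (H alpha : R) (T : nat)
  (H_gt0 : 0 < H) (alpha_gt1 : 1 < alpha) (T_gt0 : (0 < T)%N)
  (X_mean0 : zero_mean X) (X_SIM : is_DT_SIM X alpha H T)
  (X_cov_neq0 : forall n tau : nat, covR X n tau != 0) (omega : R) :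
  (forall D : 'M[R[i]]_T, is_spectral_density_at X alpha H omega D ->
    forall j r : 'I_T,
    D j r =
      ((2 * pi)^-1)%:C *
      ((htilde X (j%:Z - 1) * covR X r 0)%:C /
         ((htilde X (r%:Z - 1))%:C *
          (1 - expi (- (omega * T%:R)) *
               (alpha `^ (- (H * T%:R)))%:C * (htilde X (T%:Z - 1))%:C))
       - (htilde X (r%:Z - 1) * covR X j 0)%:C /
         ((htilde X (j%:Z - 1))%:C *
          (1 - expi (- (omega * T%:R)) *
               (alpha `^ (H * T%:R))%:C * ((htilde X (T%:Z - 1))^-1)%:C)))
      (* s = 0 term: the geometric form of Q_jr(1) is only valid for r <= j *)
      + (if (j < r)%N then
           ((2 * pi)^-1 *
            (htilde X (r%:Z - 1) * covR X j 0 / htilde X (j%:Z - 1)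
             - htilde X (j%:Z - 1) * covR X r 0 / htilde X (r%:Z - 1)))%:C
         else 0))
  /\
  (`|alpha `^ (- (H * T%:R)) * htilde X (T%:Z - 1)| != 1 ->
   exists D : 'M[R[i]]_T, is_spectral_density_at X alpha H omega D).
Proof.
have [[X2 X_SI] X_M] := X_SIM.
have X_neq0 n : moment2 X n n != 0 by rewrite -covR0 X_cov_neq0.
have X1_neq0 n : covR X n 1 != 0 by exact: X_cov_neq0.
have alpha_gt0 : 0 < alpha by exact: lt_trans alpha_gt1.
set h := hprod X.
have h_neq0 n : h n != 0 by exact: hprod_neq0.
pose lam := alpha `^ (2 * T%:R * H).
have lam_neq0 : lam != 0 by rewrite gt_eqF// powR_gt0.
pose p := alpha `^ (- (H * T%:R)); pose q := p * h T.
have p_neq0 : p != 0 by rewrite gt_eqF// powR_gt0.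
have q_neq0 : q != 0 by exact: mulf_neq0.
pose z : R[i] := expi (- (omega * T%:R)) * q%:C.
pose w : R[i] := expi (omega * T%:R) * q%:C.
(* [c j r] is E[X_j X_r] when r <= j; at s = 0 with j < r the true value is [c r j], and [dlt] is
   the difference. *)
pose c (j r : nat) := h j * covR X r 0 / h r.
pose dlt (j r : nat) := if (j < r)%N then c r j - c j r else 0.
have c_neq0 j r : c j r != 0 by rewrite /c !mulf_neq0 ?invr_neq0.
have mom j r : (r <= j)%N -> moment2 X j r = c j r.
  by move=> rj; rewrite (moment2_hprod X2)// mulrAC.
have hT n j : h (n * T + j)%N = h T ^+ n * h j by exact: hprodD X_SI _ _.
(* From s = 1 on, sT + j exceeds r for all j, r < T, so no correction arises. *)
have momT n j r : (r < T)%N -> moment2 X (n.+1 * T + j) r = h T ^+ n.+1 * c j r.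
  move=> rT; rewrite mom; first by rewrite /c hT !mulrA.
  by rewrite mulSn -addnA (leq_trans (ltnW rT))// leq_addr.
pose a (j r : 'I_T) (s : int) := ((alpha ^+ T) `^ (- (H * s%:~R)))%:C *
      expi (- (omega * s%:~R * T%:R)) * (crossQ X alpha H j r s)%:C.
have apos j r n :
    a j r (Posz n) =
    (c j r)%:C * z ^+ n + (if n is 0%N then (dlt j r)%:C else 0).
  rewrite /a -mulNr -pmulrn powR_geometric// mulNr -/p.
  have -> : - (omega * n%:R * T%:R) = - (omega * T%:R) * n%:R by ring.
  rewrite expiMn -[crossQ _ _ _ _ _ _]/(moment2 X (n * T + j) r).
  case: n => [|n]; last first.
    by rewrite momT// addr0 /z /q !(exprMn, rmorphM, rmorphXn) /=; ring.
  rewrite !expr0 !mul1r mulr1 -rmorphD /=; congr (_%:C).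
  rewrite /dlt; case: ltnP => [jr|rj]; last by rewrite addr0 mom.
  by rewrite (moment2C X2) mom 1?ltnW// addrC subrK.
have aneg j r n : a j r (Negz n) = (c r j)%:C * w ^+ n.+1.
  rewrite /a NegzE mulrNz -pmulrn -NegzE.
  have -> : - (omega * - n.+1%:R * T%:R) = omega * T%:R * n.+1%:R by ring.
  have -> : crossQ X alpha H j r (Negz n) =
      (alpha ^+ T) `^ (- (2 * n.+1%:R * H)) * moment2 X (n.+1 * T + r) j by [].
  rewrite momT// expiMn.
  (* At s = -(n+1) the weight l^(H(n+1)) meets the self-similarity factor l^(-2H(n+1)), leaving
     l^(-H(n+1)). *)
  have : (alpha ^+ T) `^ (- (H * - n.+1%:R)) *
      (alpha ^+ T) `^ (- (2 * n.+1%:R * H)) = p ^+ n.+1.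
    rewrite -powRD; last by rewrite (expf_neq0 _ (lt0r_neq0 alpha_gt0)) implybT.
    by rewrite /p -[- (H * T%:R)]mulNr -powR_geometric//; congr (_ `^ _); ring.
  move=> /(congr1 (fun x : R => x%:C)); rewrite rmorphM rmorphXn /= => pE.
  rewrite /w /q !(exprMn, rmorphM, rmorphXn) /= -pE; ring.
split=> [D DP j r|q_neq1].
  have [S [aS ->]] := DP j r.
  have c0 : (c j r)%:C != 0 by rewrite (fmorph_eq0 (real_complex R)).
  have w_neq0 : w != 0.
    by rewrite mulf_neq0 ?expi_neq0// (fmorph_eq0 (real_complex R)).
  have cw0 : (c r j)%:C * w != 0.
    by rewrite mulf_neq0// (fmorph_eq0 (real_complex R)).
  have [z1 w1 ->] := two_sided_sum_geometric c0 cw0 (apos j r) (aneg j r) aS.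
  have zE : expi (- (omega * T%:R)) * (alpha `^ (- (H * T%:R)))%:C *
      (h T)%:C = z by rewrite -mulrA -rmorphM.
  have wE : expi (- (omega * T%:R)) * (alpha `^ (H * T%:R))%:C *
      ((h T)^-1)%:C = w^-1.
    rewrite expiN -mulrA -rmorphM -[H * T%:R]opprK powRN -invfM.
    by rewrite (fmorphV (real_complex R)) -invfM.
  rewrite !htilde_hprod -/h zE wE.
  (* This produces the minus sign and the inverse of [htilde] in the second fraction. *)
  have -> : (c r j)%:C * w / (1 - w) = - ((c r j)%:C / (1 - w^-1)).
    by field; rewrite w_neq0 !subr_eq0 [1 == w]eq_sym w1.
  have quotE (u v x : R) y : (u * v)%:C / (x%:C * y) = (u * v / x)%:C / y.
    by rewrite invfM mulrA -(fmorphV (real_complex R)) -rmorphM.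
  rewrite !quotE -/(c j r) -/(c r j) /dlt addrAC mulrDr; congr (_ + _).
  by case: ifP => _; rewrite ?rmorph0 ?mulr0// -rmorphM.
exists (\matrix_(j, r) (((2 * pi)^-1)%:C *
  ((c j r)%:C / (1 - z) + (dlt j r)%:C + (c r j)%:C * w / (1 - w)))) => j r.
exists ((c j r)%:C / (1 - z) + (dlt j r)%:C + (c r j)%:C * w / (1 - w)).
rewrite mxE; split=> //.
(* Cauchy-Schwarz gives q^2 <= p^2 lam = 1, and modulus 1 is excluded by hypothesis. *)
have q_lt1 : `|q| < 1.
  rewrite lt_neqAle /q /p /h -htilde_hprod q_neq1/= htilde_hprod.
  rewrite -(@ler_pXn2r _ 2)// ?nnegrE// expr1n real_normK ?num_real//.
  have lamE : p ^+ 2 * lam = 1.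
    rewrite -powR_mulrn ?powR_ge0// -powRrM /lam -powRD; last first.
      by rewrite (lt0r_neq0 alpha_gt0) implybT.
    by rewrite (_ : _ + _ = 0) ?powRr0//; ring.
  rewrite exprMn -[leRHS]lamE ler_pM2l ?exprn_gt0 ?powR_gt0//.
  exact: hprod_sqr_le.
apply: (two_sided_sum_geometric_cvg (apos j r) (aneg j r));
  exact: cvg_expi_geometric.
Qed.
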